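(* Let $A$ and $B$ be diassociative algebras over a field $\mathbb{F}$, let $(\varphi_{\dashv},\varphi_{\vdash},\varphi_{\dashv}',\varphi_{\vdash}',f_{\dashv},f_{\vdash})$ be a factor system of $A$ by $B$, and let $L$ denote the vector space $A\oplus B$ with multiplications $$(m,i)\vdash(n,j)=(m\vdash n+\varphi_{\vdash}(i)n+\varphi_{\vdash}'(j)m+f_{\vdash}(i,j),\ i\vdash j),$$ $$(m,i)\dashv(n,j)=(m\dashv n+\varphi_{\dashv}(i)n+\varphi_{\dashv}'(j)m+f_{\dashv}(i,j),\ i\dashv j)$$ for $m,n\in A$ and $i,j\in B$. Let $\sigma:A\to L$ be given by $\sigma(m)=(m,0)$, $\pi:L\to B$ by $\pi(m,i)=i$, and $T:B\to L$ by $T(i)=(0,i)$. Then: (1) $L$ is a diassociative algebra. (2) $0\to A\xrightarrow{\sigma}L\xrightarrow{\pi}B\to0$ is an extension of $A$ by $B$. (3) $\pi T=I_B$. (4) The factor system $(\varphi_{\dashv},\varphi_{\vdash},\varphi_{\dashv}',\varphi_{\vdash}',f_{\dashv},f_{\vdash})$ belongs to the extension and $T$.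
   Context: All algebras are vector spaces over a fixed field $\mathbb{F}$. A diassociative algebra is a vector space with two associative bilinear products $\dashv,\vdash$ satisfying, for all $x,y,z$: (D1) $x\dashv(y\dashv z)=x\dashv(y\vdash z)$; (D2) $(x\vdash y)\dashv z=x\vdash(y\dashv z)$; (D3) $(x\dashv y)\vdash z=(x\vdash y)\vdash z$. Homomorphisms are linear maps preserving both products. $\mathcal{L}(A)$ is the space of linear maps $A\to A$. A factor system of $A$ by $B$ is a tuple $(\varphi_{\dashv},\varphi_{\vdash},\varphi_{\dashv}',\varphi_{\vdash}',f_{\dashv},f_{\vdash})$ with $\varphi_{\dashv},\varphi_{\vdash},\varphi_{\dashv}',\varphi_{\vdash}':B\to\mathcal{L}(A)$ linear and $f_{\dashv},f_{\vdash}:B\times B\to A$ bilinear such that for all $m,n,p\in A$, $i,j,k\in B$: 1. (a) $m\dashv(\varphi_{\dashv}(j)p)=m\dashv(\varphi_{\vdash}(j)p)$; (b) $m\dashv(\varphi_{\dashv}'(k)n)=m\dashv(\varphi_{\vdash}'(k)n)$; (c) $m\dashv f_{\dashv}(j,k)+\varphi_{\dashv}'(j\dashv k)m=m\dashv f_{\vdash}(j,k)+\varphi_{\dashv}'(j\vdash k)m$; (d) $\varphi_{\dashv}(i)(n\dashv p)=\varphi_{\dashv}(i)(n\vdash p)$; (e) $\varphi_{\dashv}(i)(\varphi_{\dashv}(j)p)=\varphi_{\dashv}(i)(\varphi_{\vdash}(j)p)$; (f) $\varphi_{\dashv}(i)(\varphi_{\dashv}'(k)n)=\varphi_{\dashv}(i)(\varphi_{\vdash}'(k)n)$;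 (g) $\varphi_{\dashv}(i)f_{\dashv}(j,k)+f_{\dashv}(i,j\dashv k)=\varphi_{\dashv}(i)f_{\vdash}(j,k)+f_{\dashv}(i,j\vdash k)$. 2. (a) $(\varphi_{\vdash}(i)n)\dashv p=\varphi_{\vdash}(i)(n\dashv p)$; (b) $(\varphi_{\vdash}'(j)m)\dashv p=m\vdash(\varphi_{\dashv}(j)p)$; (c) $f_{\vdash}(i,j)\dashv p+\varphi_{\dashv}(i\vdash j)p=\varphi_{\vdash}(i)(\varphi_{\dashv}(j)p)$; (d) $\varphi_{\dashv}'(k)(m\vdash n)=m\vdash(\varphi_{\dashv}'(k)n)$; (e) $\varphi_{\dashv}'(k)(\varphi_{\vdash}(i)n)=\varphi_{\vdash}(i)(\varphi_{\dashv}'(k)n)$; (f) $\varphi_{\dashv}'(k)(\varphi_{\vdash}'(j)m)=\varphi_{\vdash}'(j\dashv k)m+m\vdash f_{\dashv}(j,k)$; (g) $\varphi_{\dashv}'(k)f_{\vdash}(i,j)+f_{\dashv}(i\vdash j,k)=\varphi_{\vdash}(i)f_{\dashv}(j,k)+f_{\vdash}(i,j\dashv k)$. 3. (a) $(\varphi_{\dashv}(i)n)\vdash p=(\varphi_{\vdash}(i)n)\vdash p$; (b) $(\varphi_{\dashv}'(j)m)\vdash p=(\varphi_{\vdash}'(j)m)\vdash p$; (c) $f_{\dashv}(i,j)\vdash p+\varphi_{\vdash}(i\dashv j)p=f_{\vdash}(i,j)\vdash p+\varphi_{\vdash}(i\vdash j)p$; (d) $\varphi_{\vdash}'(k)(m\dashv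 n)=\varphi_{\vdash}'(k)(m\vdash n)$; (e) $\varphi_{\vdash}'(k)(\varphi_{\dashv}(i)n)=\varphi_{\vdash}'(k)(\varphi_{\vdash}(i)n)$; (f) $\varphi_{\vdash}'(k)(\varphi_{\dashv}'(j)m)=\varphi_{\vdash}'(k)(\varphi_{\vdash}'(j)m)$; (g) $\varphi_{\vdash}'(k)f_{\dashv}(i,j)+f_{\vdash}(i\dashv j,k)=\varphi_{\vdash}'(k)f_{\vdash}(i,j)+f_{\vdash}(i\vdash j,k)$. 4. (a) $m\dashv(\varphi_{\dashv}(j)p)=(\varphi_{\dashv}'(j)m)\dashv p$; (b) $m\dashv(\varphi_{\dashv}'(k)n)=\varphi_{\dashv}'(k)(m\dashv n)$; (c) $m\dashv f_{\dashv}(j,k)+\varphi_{\dashv}'(j\dashv k)m=\varphi_{\dashv}'(k)(\varphi_{\dashv}'(j)m)$; (d) $\varphi_{\dashv}(i)(n\dashv p)=(\varphi_{\dashv}(i)n)\dashv p$; (e) $\varphi_{\dashv}(i)(\varphi_{\dashv}(j)p)=\varphi_{\dashv}(i\dashv j)p+f_{\dashv}(i,j)\dashv p$; (f) $\varphi_{\dashv}(i)(\varphi_{\dashv}'(k)n)=\varphi_{\dashv}'(k)(\varphi_{\dashv}(i)n)$; (g) $\varphi_{\dashv}(i)f_{\dashv}(j,k)+f_{\dashv}(i,j\dashv k)=\varphi_{\dashv}'(k)f_{\dashv}(i,j)+f_{\dashv}(i\dashv j,k)$. 5. The identities obtained from 4(a)–(g) by replacing every $\dashv$ (including in subscripts)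 by $\vdash$. An extension of $A$ by $B$ is a short exact sequence $0\to A\xrightarrow{\sigma}L\xrightarrow{\pi}B\to0$ with $L$ a diassociative algebra and $\sigma,\pi$ homomorphisms. A section is a linear map $T:B\to L$ with $\pi T=I_B$. For $x\in L$, $m\in A$ put $P_{\dashv}(x)m=\sigma^{-1}(x\dashv\sigma(m))$, $P_{\dashv}'(x)m=\sigma^{-1}(\sigma(m)\dashv x)$, $P_{\vdash}(x)m=\sigma^{-1}(x\vdash\sigma(m))$, $P_{\vdash}'(x)m=\sigma^{-1}(\sigma(m)\vdash x)$. A factor system belongs to the extension and $T$ if $\varphi_{\dashv}=P_{\dashv}T$, $\varphi_{\vdash}=P_{\vdash}T$, $\varphi_{\dashv}'=P_{\dashv}'T$, $\varphi_{\vdash}'=P_{\vdash}'T$, $\sigma(f_{\dashv}(i,j))=T(i)\dashv T(j)-T(i\dashv j)$ and $\sigma(f_{\vdash}(i,j))=T(i)\vdash T(j)-T(i\vdash j)$ for all $i,j\in B$. *)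

(* Defs.v *)
From HB Require Import structures.
From mathcomp Require Import all_boot all_algebra.

Set Implicit Arguments.
Unset Strict Implicit.
Unset Printing Implicit Defensive.

Import GRing.Theory.
Local Open Scope ring_scope.

Record diassociative (F : fieldType) (V : lmodType F)
    (l r : V -> V -> V) : Prop := Diassociative {
  dlmul_bilinear : bilinear_for *:%R *:%R l;
  drmul_bilinear : bilinear_for *:%R *:%R r;
  dlmulA : associative l;
  drmulA : associative r;
  diassoc1 : forall x y z, l x (l y z) = l x (r y z);
  diassoc2 : forall x y z, l (r x y) z = r x (l y z);
  diassoc3 : forall x y z, r (l x y) z = r (r x y) z
}.

Record dialgType (F : fieldType) := Dialg {
  dialg_sort :> lmodType F;
  dlmul : dialg_sort -> dialg_sort -> dialg_sort;
  drmul : dialg_sort -> dialg_sort -> dialg_sort;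
  dialgP : diassociative dlmul drmul
}.
Arguments Dialg {F V l r} _ : rename.

Declare Scope dialg_scope.
Delimit Scope dialg_scope with D.
Local Open Scope dialg_scope.
Notation "x ⊣ y" := (dlmul x y)
  (at level 40, left associativity) : dialg_scope.
Notation "x ⊢ y" := (drmul x y)
  (at level 40, left associativity) : dialg_scope.

Record dialg_hom (F : fieldType) (X Y : dialgType F) (h : X -> Y) : Prop :=
  DialgHom {
  hom_linear : linear h;
  hom_dlmul : forall x y, h (x ⊣ y) = h x ⊣ h y;
  hom_drmul : forall x y, h (x ⊢ y) = h x ⊢ h y
}.

(* In the identities below, the suffix XYZ records which of A and B the three
   arguments of the underlying threefold product are taken from. *)

Record assoc_identities (F : fieldType) (A B : dialgType F)
    (mulA : A -> A -> A) (mulB : B -> B -> B)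
    (phi phi' : B -> {linear A -> A}) (f : B -> B -> A) : Prop :=
  AssocIdentities {
  assoc_ABA : forall m j p, mulA m (phi j p) = mulA (phi' j m) p;
  assoc_AAB : forall m n k, mulA m (phi' k n) = phi' k (mulA m n);
  assoc_ABB : forall m j k,
    mulA m (f j k) + phi' (mulB j k) m = phi' k (phi' j m);
  assoc_BAA : forall i n p, phi i (mulA n p) = mulA (phi i n) p;
  assoc_BBA : forall i j p,
    phi i (phi j p) = phi (mulB i j) p + mulA (f i j) p;
  assoc_BAB : forall i n k, phi i (phi' k n) = phi' k (phi i n);
  assoc_BBB : forall i j k,
    phi i (f j k) + f i (mulB j k) = phi' k (f i j) + f (mulB i j) k
}.

(* The suffixes l and r stand for the products ⊣ and ⊢. A linear map from B to
   the space of linear maps A -> A is a map into {linear A -> A} whose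
   evaluation at each m in A is linear, since MathComp has no lmodType
   structure on {linear A -> A}. *)
Record factor_system (F : fieldType) (A B : dialgType F) := FactorSystem {
  phil : B -> {linear A -> A};
  phir : B -> {linear A -> A};
  phil' : B -> {linear A -> A};
  phir' : B -> {linear A -> A};
  fl : B -> B -> A;
  fr : B -> B -> A;
  phil_linear : forall m, linear (fun i => phil i m);
  phir_linear : forall m, linear (fun i => phir i m);
  phil'_linear : forall m, linear (fun i => phil' i m);
  phir'_linear : forall m, linear (fun i => phir' i m);
  fl_bilinear : bilinear_for *:%R *:%R fl;
  fr_bilinear : bilinear_for *:%R *:%R fr;
  fs1_ABA : forall m j p, m ⊣ phil j p = m ⊣ phir j p;
  fs1_AAB : forall m n k, m ⊣ phil' k n = m ⊣ phir' k n;
  fs1_ABB : forall m j k,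
    m ⊣ fl j k + phil' (j ⊣ k) m = m ⊣ fr j k + phil' (j ⊢ k) m;
  fs1_BAA : forall i n p, phil i (n ⊣ p) = phil i (n ⊢ p);
  fs1_BBA : forall i j p, phil i (phil j p) = phil i (phir j p);
  fs1_BAB : forall i n k, phil i (phil' k n) = phil i (phir' k n);
  fs1_BBB : forall i j k,
    phil i (fl j k) + fl i (j ⊣ k) = phil i (fr j k) + fl i (j ⊢ k);
  fs2_BAA : forall i n p, phir i n ⊣ p = phir i (n ⊣ p);
  fs2_ABA : forall m j p, phir' j m ⊣ p = m ⊢ phil j p;
  fs2_BBA : forall i j p,
    fr i j ⊣ p + phil (i ⊢ j) p = phir i (phil j p);
  fs2_AAB : forall m n k, phil' k (m ⊢ n) = m ⊢ phil' k n;
  fs2_BAB : forall i n k, phil' k (phir i n) = phir i (phil' k n);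
  fs2_ABB : forall m j k,
    phil' k (phir' j m) = phir' (j ⊣ k) m + m ⊢ fl j k;
  fs2_BBB : forall i j k,
    phil' k (fr i j) + fl (i ⊢ j) k = phir i (fl j k) + fr i (j ⊣ k);
  fs3_BAA : forall i n p, phil i n ⊢ p = phir i n ⊢ p;
  fs3_ABA : forall m j p, phil' j m ⊢ p = phir' j m ⊢ p;
  fs3_BBA : forall i j p,
    fl i j ⊢ p + phir (i ⊣ j) p = fr i j ⊢ p + phir (i ⊢ j) p;
  fs3_AAB : forall m n k, phir' k (m ⊣ n) = phir' k (m ⊢ n);
  fs3_BAB : forall i n k, phir' k (phil i n) = phir' k (phir i n);
  fs3_ABB : forall m j k, phir' k (phil' j m) = phir' k (phir' j m);
  fs3_BBB : forall i j k,
    phir' k (fl i j) + fr (i ⊣ j) k = phir' k (fr i j) + fr (i ⊢ j) k;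
  fs4 : assoc_identities (@dlmul F A) (@dlmul F B) phil phil' fl;
  fs5 : assoc_identities (@drmul F A) (@drmul F B) phir phir' fr
}.

Record is_extension (F : fieldType) (A B L : dialgType F)
    (sigma : A -> L) (pi : L -> B) : Prop := IsExtension {
  sigma_hom : dialg_hom sigma;
  pi_hom : dialg_hom pi;
  sigma_inj : injective sigma;
  im_sigma_ker_pi : forall x, (exists m, sigma m = x) <-> pi x = 0;
  pi_surj : forall i, exists x, pi x = i
}.

Definition is_section (F : fieldType) (B L : dialgType F)
    (pi : L -> B) (T : B -> L) : Prop :=
  linear T /\ (forall i, pi (T i) = i).

Section Extension.
Variables (F : fieldType) (A B L : dialgType F).
Variables (sigma : A -> L) (pi : L -> B) (E : is_extension sigma pi).

Lemma ker_pi_sub_im x : pi x = 0 -> exists m, sigma m == x.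
Proof. by case/(im_sigma_ker_pi E) => m <-; exists m. Qed.

Definition sigma_inv (x : L) (kx : pi x = 0) : A := xchoose (ker_pi_sub_im kx).

Lemma pi_sigma m : pi (sigma m) = 0.
Proof. by apply/(im_sigma_ker_pi E); exists m. Qed.

Lemma linear_at0 (U V : lmodType F) (f : U -> V) : linear f -> f 0 = 0.
Proof. by move=> fl; have := fl (-1) 0 0; rewrite !scaleN1r !addNr. Qed.

Lemma pi_dlmul_sigma x m : pi (x ⊣ sigma m) = 0.
Proof.
rewrite (hom_dlmul (pi_hom E)) pi_sigma.
exact: linear_at0 ((dlmul_bilinear (dialgP B)).2 _).
Qed.

Lemma pi_sigma_dlmul m x : pi (sigma m ⊣ x) = 0.
Proof.
rewrite (hom_dlmul (pi_hom E)) pi_sigma.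
exact: linear_at0 ((dlmul_bilinear (dialgP B)).1 _).
Qed.

Lemma pi_drmul_sigma x m : pi (x ⊢ sigma m) = 0.
Proof.
rewrite (hom_drmul (pi_hom E)) pi_sigma.
exact: linear_at0 ((drmul_bilinear (dialgP B)).2 _).
Qed.

Lemma pi_sigma_drmul m x : pi (sigma m ⊢ x) = 0.
Proof.
rewrite (hom_drmul (pi_hom E)) pi_sigma.
exact: linear_at0 ((drmul_bilinear (dialgP B)).1 _).
Qed.

Definition Pl (x : L) (m : A) : A := sigma_inv (pi_dlmul_sigma x m).
Definition Pl' (x : L) (m : A) : A := sigma_inv (pi_sigma_dlmul m x).
Definition Pr (x : L) (m : A) : A := sigma_inv (pi_drmul_sigma x m).
Definition Pr' (x : L) (m : A) : A := sigma_inv (pi_sigma_drmul m x).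

Record belongs (S : factor_system A B) (T : B -> L) : Prop := Belongs {
  belongs_phil : forall i m, phil S i m = Pl (T i) m;
  belongs_phir : forall i m, phir S i m = Pr (T i) m;
  belongs_phil' : forall i m, phil' S i m = Pl' (T i) m;
  belongs_phir' : forall i m, phir' S i m = Pr' (T i) m;
  belongs_fl : forall i j, sigma (fl S i j) = T i ⊣ T j - T (i ⊣ j);
  belongs_fr : forall i j, sigma (fr S i j) = T i ⊢ T j - T (i ⊢ j)
}.

End Extension.

Section Construction.
Variables (F : fieldType) (A B : dialgType F) (S : factor_system A B).

Definition fs_lmul (x y : A * B) : A * B :=
  (x.1 ⊣ y.1 + phil S x.2 y.1 + phil' S y.2 x.1 + fl S x.2 y.2, x.2 ⊣ y.2).

Definition fs_rmul (x y : A * B) : A * B :=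
  (x.1 ⊢ y.1 + phir S x.2 y.1 + phir' S y.2 x.1 + fr S x.2 y.2, x.2 ⊢ y.2).

Definition fs_sigma (m : A) : A * B := (m, 0).
Definition fs_pi (x : A * B) : B := x.2.
Definition fs_T (i : B) : A * B := (0, i).

End Construction.

(* Main.v *)
Require Import Defs.
From mathcomp Require Import all_boot all_algebra.

(** Evaluating a product of three elements of [A (+) B] in the twisted
multiplication splits it, by multilinearity, into eight parts, one for each way
of choosing every factor from [A] or from [B]. The part where all three factors
come from [A] is the product in [A]; the other seven, compared between the two
sides of an axiom, give seven identities of a factor system, while the
[B]-component is the product in [B]. Hence each of the five axioms of a
diassociative algebra for [A (+) B] is the same axiom for [A], plus seven
identities of the factor system, plus the same axiom for [B].

Only two shapes of threefold product occur, [(x * y) # z] and [x * (y # z)],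
with [*] and [#] ranging over the two multiplications. So the splitting is done
once, for two unrelated twisted products: [crossed_mul_mull] and
[crossed_mul_mulr]. The remaining claims hold because the
[A]-component of a twisted product of [(m, 0)] and [(0, i)], in either order,
reduces to one action term, that of [(m, 0)] and [(n, 0)] to the product in
[A], and that of [(0, i)] and [(0, j)] to the cocycle; injectivity of the
inclusion of [A] then identifies the actions induced by the extension. *)

Set Implicit Arguments.
Unset Strict Implicit.
Unset Printing Implicit Defensive.

Import GRing.Theory.
Local Open Scope ring_scope.
Local Open Scope dialg_scope.

Lemma linear_forD (F : fieldType) (U V : lmodType F) (f : U -> V) :
  linear f -> {morph f : x y / x + y}.
Proof. by move=> lf x y; have := lf 1 x y; rewrite !scale1r. Qed.

Section BilinearFacts.
Variables (F : fieldType) (U V W : lmodType F).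
Variables (f : U -> V -> W) (bf : bilinear_for *:%R *:%R f).

Lemma bilinDl x y z : f (x + y) z = f x z + f y z.
Proof. exact: (linear_forD (bf.1 z)). Qed.

Lemma bilinDr x y z : f x (y + z) = f x y + f x z.
Proof. exact: (linear_forD (bf.2 x)). Qed.

Lemma bilin0l z : f 0 z = 0.
Proof. exact: (linear_at0 (bf.1 z)). Qed.

Lemma bilin0r x : f x 0 = 0.
Proof. exact: (linear_at0 (bf.2 x)). Qed.

End BilinearFacts.

(** The part of a factor system that concerns a single product, reduced to
multilinearity: the splitting of threefold products depends on nothing else,
and the two products of a diassociative algebra can then be treated alike. *)
Record crossing (F : fieldType) (A B : lmodType F) := Crossing {
  cmulA : A -> A -> A;
  cmulB : B -> B -> B;
  cact : B -> {linear A -> A};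
  cact' : B -> {linear A -> A};
  ccocycle : B -> B -> A;
  cmulA_bilinear : bilinear_for *:%R *:%R cmulA;
  cmulB_bilinear : bilinear_for *:%R *:%R cmulB;
  cact_linear : forall m, linear (fun i => cact i m);
  cact'_linear : forall m, linear (fun i => cact' i m);
  ccocycle_bilinear : bilinear_for *:%R *:%R ccocycle
}.

Section CrossedProduct.
Variables (F : fieldType) (A B : lmodType F).
Implicit Types (c d : crossing A B) (x y z : A * B).

Definition crossed_mul c x y : A * B :=
  (cmulA c x.1 y.1 + cact c x.2 y.1 + cact' c y.2 x.1 + ccocycle c x.2 y.2,
   cmulB c x.2 y.2).

Lemma crossed_mul_bilinear c : bilinear_for *:%R *:%R (crossed_mul c).
Proof.
split=> [[n j]|[m i]] a [m1 i1] [m2 i2]; rewrite /crossed_mul /=.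
- rewrite ((cmulA_bilinear c).1 n) ((cmulB_bilinear c).1 j).
  rewrite ((ccocycle_bilinear c).1 j) (cact_linear c n) linearP /=.
  by congr pair; rewrite /= !scalerDr !addrA [LHS](ACl (1*3*5*7*2*4*6*8)).
- rewrite ((cmulA_bilinear c).2 m) ((cmulB_bilinear c).2 i).
  rewrite ((ccocycle_bilinear c).2 i) (cact'_linear c m) linearP /=.
  by congr pair; rewrite /= !scalerDr !addrA [LHS](ACl (1*3*5*7*2*4*6*8)).
Qed.

(** The eight summands are listed by the origin of the three factors, in the
order AAA, AAB, ABA, BAA, ABB, BAB, BBA, BBB, both here and in
[crossed_mul_mulr]; thus the two lemmas match summand by summand. *)
Lemma crossed_mul_mull c d m n p i j k :
  crossed_mul d (crossed_mul c (m, i) (n, j)) (p, k) =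
  (cmulA d (cmulA c m n) p
   + cact' d k (cmulA c m n)
   + cmulA d (cact' c j m) p
   + cmulA d (cact c i n) p
   + cact' d k (cact' c j m)
   + cact' d k (cact c i n)
   + (cmulA d (ccocycle c i j) p + cact d (cmulB c i j) p)
   + (cact' d k (ccocycle c i j) + ccocycle d (cmulB c i j) k),
   cmulB d (cmulB c i j) k).
Proof.
rewrite /crossed_mul /=; congr pair.
rewrite !(bilinDl (cmulA_bilinear d)) !linearD !addrA.
by rewrite (ACl (1*6*3*2*8*7*4*5*9*10)).
Qed.

Lemma crossed_mul_mulr c d m n p i j k :
  crossed_mul c (m, i) (crossed_mul d (n, j) (p, k)) =
  (cmulA c m (cmulA d n p)
   + cmulA c m (cact' d k n)
   + cmulA c m (cact d j p)
   + cact c i (cmulA d n p)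
   + (cmulA c m (ccocycle d j k) + cact' c (cmulB d j k) m)
   + cact c i (cact' d k n)
   + cact c i (cact d j p)
   + (cact c i (ccocycle d j k) + ccocycle c i (cmulB d j k)),
   cmulB c i (cmulB d j k)).
Proof.
rewrite /crossed_mul /=; congr pair.
rewrite !(bilinDr (cmulA_bilinear c)) !linearD !addrA.
by rewrite (ACl (1*3*2*5*4*9*7*6*8*10)).
Qed.

End CrossedProduct.

(** Each of the seven identities equates one of the seven summands, other than
AAA, of the two bracketings of a threefold product. *)
Lemma crossed_mulA (F : fieldType) (A B : dialgType F) (c : crossing A B) :
  associative (cmulA c) -> associative (cmulB c) ->
  assoc_identities (cmulA c) (cmulB c) (cact c) (cact' c) (ccocycle c) ->
  associative (crossed_mul c).
Proof.
move=> mulA mulB [ABA AAB ABB BAA BBA BAB BBB] [m i] [n j] [p k].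
rewrite crossed_mul_mulr crossed_mul_mull mulA mulB AAB ABA BAA ABB BAB BBA.
by rewrite BBB [X in _ + X + _]addrC.
Qed.

Section FactorSystemProducts.
Variables (F : fieldType) (A B : dialgType F) (S : factor_system A B).

Definition lcrossing : crossing A B :=
  Crossing (dlmul_bilinear (dialgP A)) (dlmul_bilinear (dialgP B))
    (@phil_linear F A B S) (@phil'_linear F A B S) (fl_bilinear S).

Definition rcrossing : crossing A B :=
  Crossing (drmul_bilinear (dialgP A)) (drmul_bilinear (dialgP B))
    (@phir_linear F A B S) (@phir'_linear F A B S) (fr_bilinear S).

Lemma fs_lmulE : fs_lmul S = crossed_mul lcrossing.
Proof. by []. Qed.

Lemma fs_rmulE : fs_rmul S = crossed_mul rcrossing.
Proof. by []. Qed.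

Lemma fs_diassociative :
  @diassociative F (A * B)%type (fs_lmul S) (fs_rmul S).
Proof.
rewrite fs_lmulE fs_rmulE; split.
- exact: crossed_mul_bilinear.
- exact: crossed_mul_bilinear.
- exact: (@crossed_mulA F A B lcrossing
    (dlmulA (dialgP A)) (dlmulA (dialgP B)) (fs4 S)).
- exact: (@crossed_mulA F A B rcrossing
    (drmulA (dialgP A)) (drmulA (dialgP B)) (fs5 S)).
- move=> [m i] [n j] [p k]; rewrite !crossed_mul_mulr /=.
  rewrite (diassoc1 (dialgP A)) fs1_AAB fs1_ABA fs1_BAA fs1_ABB fs1_BAB.
  by rewrite fs1_BBA fs1_BBB (diassoc1 (dialgP B)).
- move=> [m i] [n j] [p k]; rewrite crossed_mul_mull crossed_mul_mulr /=.
  rewrite (diassoc2 (dialgP A)) fs2_AAB fs2_ABA fs2_BAA fs2_ABB fs2_BAB.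
  rewrite fs2_BBA fs2_BBB (diassoc2 (dialgP B)).
  by rewrite [phir' S _ _ + _]addrC.
- move=> [m i] [n j] [p k]; rewrite !crossed_mul_mull /=.
  rewrite (diassoc3 (dialgP A)) fs3_AAB fs3_ABA fs3_BAA fs3_ABB fs3_BAB.
  by rewrite fs3_BBA fs3_BBB (diassoc3 (dialgP B)).
Qed.

End FactorSystemProducts.

Section CrossedProductOfSpecialElements.
Variables (F : fieldType) (A B : lmodType F) (c : crossing A B).

Lemma crossed_mul_AA m n : crossed_mul c (m, 0) (n, 0) = (cmulA c m n, 0).
Proof.
rewrite /crossed_mul /= (linear_at0 (cact_linear c n)).
rewrite (linear_at0 (cact'_linear c m)) (bilin0l (ccocycle_bilinear c)).
by rewrite (bilin0l (cmulB_bilinear c)) !addr0.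
Qed.

Lemma crossed_mul_BA i m : crossed_mul c (0, i) (m, 0) = (cact c i m, 0).
Proof.
rewrite /crossed_mul /= (bilin0l (cmulA_bilinear c)) raddf0.
rewrite (bilin0r (ccocycle_bilinear c)) (bilin0r (cmulB_bilinear c)).
by rewrite add0r !addr0.
Qed.

Lemma crossed_mul_AB m i : crossed_mul c (m, 0) (0, i) = (cact' c i m, 0).
Proof.
rewrite /crossed_mul /= (bilin0r (cmulA_bilinear c)) raddf0.
rewrite (bilin0l (ccocycle_bilinear c)) (bilin0l (cmulB_bilinear c)).
by rewrite !add0r !addr0.
Qed.

Lemma crossed_mul_BB i j :
  crossed_mul c (0, i) (0, j) = (ccocycle c i j, cmulB c i j).
Proof.
by rewrite /crossed_mul /= (bilin0l (cmulA_bilinear c)) !raddf0 !add0r.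
Qed.

End CrossedProductOfSpecialElements.

Lemma sigma_invK (F : fieldType) (A B L : dialgType F) (sigma : A -> L)
    (pi : L -> B) (E : is_extension sigma pi) x (kx : pi x = 0) :
  sigma (sigma_inv E kx) = x.
Proof. exact/eqP/(xchooseP (ker_pi_sub_im E kx)). Qed.

Section FactorSystemExtension.
Variables (F : fieldType) (A B : dialgType F) (S : factor_system A B).

Let L : dialgType F := Dialg (fs_diassociative S).

Lemma fs_is_extension :
  @is_extension F A B L (@fs_sigma F A B) (@fs_pi F A B).
Proof.
split=> //.
- split=> [a m n|m n|m n]; rewrite /fs_sigma.
  + by congr pair; rewrite /= scaler0 addr0.
  + exact: esym (crossed_mul_AA (lcrossing S) m n).
  + exact: esym (crossed_mul_AA (rcrossing S) m n).
- by move=> m n [].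
- move=> [m i]; split=> [[n [_ <-]] //|]; rewrite /fs_pi /= => ->.
  by exists m.
- by move=> i; exists (0, i).
Qed.

Lemma fs_is_section : @is_section F B L (@fs_pi F A B) (@fs_T F A B).
Proof.
by split=> // a i j; rewrite /fs_T; congr pair; rewrite /= scaler0 addr0.
Qed.

Lemma fs_belongs : belongs fs_is_extension S (@fs_T F A B).
Proof.
have BBE (c : crossing A B) i j :
    fs_sigma B (ccocycle c i j) =
    crossed_mul c (fs_T A i) (fs_T A j) - fs_T A (cmulB c i j).
  by rewrite crossed_mul_BB; congr pair; rewrite /= ?subr0 ?subrr.
split=> [i m|i m|i m|i m|i j|i j].
- apply: (sigma_inj fs_is_extension); rewrite [RHS]sigma_invK.
  exact: esym (crossed_mul_BA (lcrossing S) i m).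
- apply: (sigma_inj fs_is_extension); rewrite [RHS]sigma_invK.
  exact: esym (crossed_mul_BA (rcrossing S) i m).
- apply: (sigma_inj fs_is_extension); rewrite [RHS]sigma_invK.
  exact: esym (crossed_mul_AB (lcrossing S) m i).
- apply: (sigma_inj fs_is_extension); rewrite [RHS]sigma_invK.
  exact: esym (crossed_mul_AB (rcrossing S) m i).
- exact: (BBE (lcrossing S)).
- exact: (BBE (rcrossing S)).
Qed.

End FactorSystemExtension.

Theorem theorem4p2 (F : fieldType) (A B : dialgType F)
    (S : factor_system A B) :
  exists HL : @diassociative F (A * B)%type (fs_lmul S) (fs_rmul S),
  let L : dialgType F := Dialg HL in
  exists HE : @is_extension F A B L (@fs_sigma F A B) (@fs_pi F A B),
    @is_section F B L (@fs_pi F A B) (@fs_T F A B)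
    /\ belongs HE S (@fs_T F A B).
Proof.
exists (fs_diassociative S); exists (fs_is_extension S).
by split; [exact: fs_is_section | exact: fs_belongs].
Qed.
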